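(* Let $T$ be a complete first order theory, $\mathfrak{C}$ a monster model of $T$, and $\bar c$ an enumeration of $\mathfrak{C}$. (1) $T$ has DEERP if and only if the ambit $(\mathrm{Aut}(\mathfrak{C}),S_{\bar c}(\mathfrak{C}),\mathrm{tp}(\bar c/\mathfrak{C}))$ has DRP; and $T$ has EDEERP if and only if the ambit $(\mathrm{Aut}(\mathfrak{C}),S_{\bar c}(\mathfrak{C}),\mathrm{tp}(\bar c/\mathfrak{C}))$ has EDRP. (2) $T$ has sep. fin. EDEERdeg if and only if the ambit $(\mathrm{Aut}(\mathfrak{C}),S_{\bar c}(\mathfrak{C}),\mathrm{tp}(\bar c/\mathfrak{C}))$ has sep. fin. EDRdeg.
   Context: Model-theoretic side. $S_{\bar y}(\mathfrak{C})$ is the space of complete types over $\mathfrak{C}$ in variables $\bar y$; $S_{\bar c}(\mathfrak{C})$ is the space of complete types over $\mathfrak{C}$ extending $\mathrm{tp}(\bar c/\emptyset)$, with the natural action of $\mathrm{Aut}(\mathfrak{C})$. For a finite tuple $\bar a$ in $\mathfrak{C}$ and $C\subseteq\mathfrak{C}$, $\binom{C}{\bar a}$ is the set of tuples $\bar a'\in C^{|\bar a|}$ with $\bar a'\equiv\bar a$ (same type over $\emptyset$); for finite $B\subseteq\mathfrak{C}$, $\binom{\mathfrak{C}}{B}$ is the set of images of $B$ under $\mathrm{Aut}(\mathfrak{C})$. A coloring $c\colon\binom{\mathfrak{C}}{\bar a}\to 2^n$ is definable if there are formulas $\varphi_i(\bar x)$, $i<n$, with parameters from $\mathfrak{C}$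 such that $c(\bar a')(i)=1$ iff $\models\varphi_i(\bar a')$. It is externally definable if there are formulas without parameters $\varphi_i(\bar x,\bar y)$ and types $p_i(\bar y)\in S_{\bar y}(\mathfrak{C})$, $i<n$, such that $c(\bar a')(i)=1$ iff $\varphi_i(\bar a',\bar y)\in p_i(\bar y)$. For a set $\Delta$ of formulas without parameters in variables $\bar x$ (corresponding to $\bar a$) and $\bar y$ (with $|\bar y|=|\bar c|$), $c$ is an externally definable $\Delta$-coloring if in addition all $\varphi_i\in\Delta$ and all $p_i\in S_{\bar c}(\mathfrak{C})$. $T$ has DEERP [resp. EDEERP] if for every finite $B\subseteq\mathfrak{C}$, finite tuple $\bar a\subseteq B$, $n<\omega$ and definable [resp. externally definable] coloring $c\colon\binom{\mathfrak{C}}{\bar a}\to 2^n$ there is $B'\in\binom{\mathfrak{C}}{B}$ with $|c[\binom{B'}{\bar a}]|=1$. $T$ has sep. fin. EDEERdeg if for every finite tuple $\bar a$ and finite set of formulas $\Delta$ there is $l=l(\bar a,\Delta)<\omega$ such that for every finite $B\subseteq\mathfrak{C}$ containing $\bar a$, every $n<\omega$ and every externally definable $\Delta$-coloring $c\colon\binom{\mathfrak{C}}{\bar a}\to 2^n$ there is $B'\in\binom{\mathfrak{C}}{B}$ with $|c[\binom{B'}{\bar a}]|\le l$. Dynamical side. For a $0$-dimensional ambit $(G,X,x_0)$ (compact Hausdorff $0$-dimensional $X$ with a continuous $G$-action, $Gx_0$ dense) with algebra of clopen sets $\mathcal{B}$: for $S\subseteq X$ and $\Sigma\subseteq\mathcal{B}$,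 a coloring $c\colon G\to 2^n$ ($n\ge1$) is an $S$-definable $\Sigma$-coloring if there are $U_0,\dots,U_{n-1}\in\Sigma$, $y_0,\dots,y_{n-1}\in S$ such that for all $g\in G$, $i<n$: $c(g)(i)=1$ iff $y_i\in gU_i$. DRP [resp. EDRP]: for every $S$-definable $\mathcal{B}$-coloring $c\colon G\to 2^n$ with $S=Gx_0$ [resp. $S=X$] and every finite nonempty $A\subseteq G$ there is $h\in G$ with $|c[hA]|=1$. Sep. fin. EDRdeg: for every finite $\Sigma\subseteq\mathcal{B}$ there is $l\ge1$ such that for every $X$-definable $\Sigma$-coloring $c\colon G\to 2^n$ (any $n\ge1$) and every finite nonempty $A\subseteq G$ there is $h\in G$ with $|c[hA]|\le l$. *)

(* Defs.v *)
From HB Require Import structures.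
From mathcomp Require Import all_boot.
From mathcomp Require Import all_classical topology.

Set Implicit Arguments.
Unset Strict Implicit.
Unset Printing Implicit Defensive.

Local Open Scope classical_set_scope.
Local Open Scope card_scope.

Section Syntax.

Record language := Language {
  funs : Type;
  fun_arity : funs -> nat;
  rels : Type;
  rel_arity : rels -> nat }.

Variable L : language.

Inductive term (V : Type) : Type :=
| Tvar of V
| Tapp (f : funs L) of ('I_(fun_arity f) -> term V).

(* [formula V] is the type of first-order formulas whose free variables are
   among the elements of [V]; a quantifier binds the variable [None]. *)
Inductive formula (V : Type) : Type :=
| Feq of term V & term V
| Frel (r : rels L) of ('I_(rel_arity r) -> term V)
| Fnot of formula V
| Fand of formula V & formula V
| Fex of formula (option V).

Definition Ftrue V : formula V := Fex (Feq (Tvar None) (Tvar None)).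

Definition sentence := formula void.

Fixpoint trename V W (e : V -> W) (t : term V) : term W :=
  match t with
  | Tvar v => Tvar (e v)
  | Tapp f ts => @Tapp W f (fun i => trename e (ts i))
  end.

Fixpoint rename V W (e : V -> W) (phi : formula V) : formula W :=
  match phi with
  | Feq t u => Feq (trename e t) (trename e u)
  | Frel r ts => @Frel W r (fun i => trename e (ts i))
  | Fnot phi => Fnot (rename e phi)
  | Fand phi psi => Fand (rename e phi) (rename e psi)
  | Fex phi => Fex (rename (omap e) phi)
  end.

End Syntax.

HB.instance Definition _ L V := gen_eqMixin (formula L V).
HB.instance Definition _ L V := gen_choiceMixin (formula L V).
HB.instance Definition _ L V := isPointed.Build (formula L V) (Ftrue L V).

(* [vsum f g] assigns [f] to the variables in [A] and [g] to those in [B]; in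
   a formula over [V + P] the elements of [P] usually play the role of
   parameters. *)
Definition vsum A B C (f : A -> C) (g : B -> C) (x : A + B) : C :=
  match x with inl a => f a | inr b => g b end.

Section Semantics.
Variable L : language.

Record structure := Structure {
  carrier :> Type;
  carrier_inhabited : inhabited carrier;
  fun_interp : forall f : funs L, ('I_(fun_arity f) -> carrier) -> carrier;
  rel_interp : forall r : rels L, ('I_(rel_arity r) -> carrier) -> Prop }.

Fixpoint eval (M : structure) V (v : V -> M) (t : term L V) : M :=
  match t with
  | Tvar x => v x
  | Tapp f ts => fun_interp (fun i => eval v (ts i))
  end.

Fixpoint sat (M : structure) V (v : V -> M) (phi : formula L V) : Prop :=
  match phi with
  | Feq t u => eval v t = eval v u
  | Frel r ts => rel_interp (fun i => eval v (ts i))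
  | Fnot phi => ~ sat v phi
  | Fand phi psi => sat v phi /\ sat v psi
  | Fex phi => exists m : M, sat (oapp v m) phi
  end.

Definition holds (M : structure) (phi : sentence L) := sat (of_void M) phi.

Definition models (M : structure) (T : set (sentence L)) :=
  forall phi, T phi -> holds M phi.

Definition entails (T : set (sentence L)) (phi : sentence L) :=
  forall M, models M T -> holds M phi.

Definition complete_theory (T : set (sentence L)) :=
  (exists M, models M T) /\
  forall phi, entails T phi \/ entails T (Fnot phi).

End Semantics.

Section Types.
Variables (L : language) (M : structure L).

Definition tp V (a : V -> M) : set (formula L V) := [set phi | sat a phi].

(* Complete types, in the variables [V], over the parameters [e : P -> M].
   Consistency with the elementary diagram of [M] is finite satisfiability
   in [M]. *)
Definition complete_type V P (e : P -> M) (p : set (formula L (V + P))) :=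
  (forall s : set (formula L (V + P)), finite_set s -> s `<=` p ->
     exists v : V -> M, s `<=` tp (vsum v e)) /\
  (forall phi, p phi \/ p (Fnot phi)).

Definition types_over V : set (set (formula L (V + M))) :=
  [set p | complete_type id p].

End Types.

Arguments types_over {L} M V _.

Section Automorphisms.
Variables (L : language) (M : structure L).

Record aut := Aut {
  aut_fun :> M -> M;
  aut_inv : M -> M;
  aut_funK : cancel aut_fun aut_inv;
  aut_invK : cancel aut_inv aut_fun;
  aut_funs : forall (f : funs L) (x : 'I_(fun_arity f) -> M),
    aut_fun (fun_interp x) = fun_interp (aut_fun \o x);
  aut_rels : forall (r : rels L) (x : 'I_(rel_arity r) -> M),
    rel_interp (aut_fun \o x) <-> rel_interp x }.

Lemma aut_ext (s t : aut) : (forall m, s m = t m) -> s = t.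
Proof.
case: s t => [s s' sK s'K sf sr] [t t' tK t'K tf tr] /= st.
have {st} est : s = t by apply/funext.
subst t.
have est' : s' = t' by apply/funext => m; rewrite -{1}[m]t'K sK.
subst t'.
by congr Aut; exact: Prop_irrelevance.
Qed.

Lemma aut1_rels (r : rels L) (x : 'I_(rel_arity r) -> M) :
  rel_interp (id \o x) <-> rel_interp x.
Proof. by []. Qed.

Definition aut1 : aut :=
  @Aut id id (fun _ => erefl) (fun _ => erefl) (fun _ _ => erefl) aut1_rels.

Section Mul.
Variables s t : aut.

Lemma autM_funK : cancel (s \o t) (aut_inv t \o aut_inv s).
Proof. by move=> m /=; rewrite !aut_funK. Qed.

Lemma autM_invK : cancel (aut_inv t \o aut_inv s) (s \o t).
Proof. by move=> m /=; rewrite !aut_invK. Qed.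

Lemma autM_funs (f : funs L) (x : 'I_(fun_arity f) -> M) :
  (s \o t) (fun_interp x) = fun_interp ((s \o t) \o x).
Proof. by rewrite /= !aut_funs. Qed.

Lemma autM_rels (r : rels L) (x : 'I_(rel_arity r) -> M) :
  rel_interp ((s \o t) \o x) <-> rel_interp x.
Proof. exact: iff_trans (aut_rels s _) (aut_rels t _). Qed.

Definition autM : aut := Aut autM_funK autM_invK autM_funs autM_rels.

Lemma autV_funs (f : funs L) (x : 'I_(fun_arity f) -> M) :
  aut_inv s (fun_interp x) = fun_interp (aut_inv s \o x).
Proof.
apply: (can_inj (aut_funK s)); rewrite aut_invK aut_funs.
by congr fun_interp; apply/funext => i /=; rewrite aut_invK.
Qed.

Lemma autV_rels (r : rels L) (x : 'I_(rel_arity r) -> M) :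
  rel_interp (aut_inv s \o x) <-> rel_interp x.
Proof.
apply: iff_trans (iff_sym (aut_rels s _)) _.
suff -> : s \o (aut_inv s \o x) = x by [].
by apply/funext => i /=; rewrite aut_invK.
Qed.

Definition autV : aut := Aut (aut_invK s) (aut_funK s) autV_funs autV_rels.

End Mul.

HB.instance Definition _ := gen_eqMixin aut.
HB.instance Definition _ := gen_choiceMixin aut.

Lemma autMA : associative autM.
Proof. by move=> s t u; apply: aut_ext. Qed.
Lemma aut1M : left_id aut1 autM.
Proof. by move=> s; apply: aut_ext. Qed.
Lemma autM1 : right_id aut1 autM.
Proof. by move=> s; apply: aut_ext. Qed.
Lemma autVM : left_inverse aut1 autV autM.
Proof. by move=> s; apply: aut_ext => m /=; rewrite aut_funK. Qed.
Lemma autMV : right_inverse aut1 autV autM.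
Proof. by move=> s; apply: aut_ext => m /=; rewrite aut_invK. Qed.

HB.instance Definition _ := isGroup.Build aut autMA aut1M autM1 autVM autMV.

Definition agree (s : aut) (A : set M) : set aut :=
  [set t | forall m, A m -> t m = s m].

(* A base of the topology of pointwise convergence, [M] being discrete. *)
Definition aut_basic : set (set aut) :=
  [set U | exists2 A : set M, finite_set A & exists s : aut, U = agree s A].

Lemma aut_basic_cover : \bigcup_(U in aut_basic) id U = setT.
Proof.
apply/seteqP; split=> // s _; exists setT => //=.
exists set0; first exact: finite_set0.
by exists s; apply/esym/seteqP; split=> // t _ m [].
Qed.

Lemma aut_basic_join (U V : set aut) t : aut_basic U -> aut_basic V ->
  id U t -> id V t ->
  exists W, [/\ aut_basic W, id W t & id W `<=` id U `&` id V].
Proof.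
move=> [A fA [s ->]] [B fB [s' ->]] /= tA tB.
exists (agree t (A `|` B)); split => //.
  by exists (A `|` B); [rewrite finite_setU|exists t].
move=> u /= ut; split=> m mA; first by rewrite ut ?tA//; left.
by rewrite ut ?tB//; right.
Qed.

HB.instance Definition _ :=
  isBaseTopological.Build aut aut_basic_cover aut_basic_join.

End Automorphisms.

Section Monster.
Variable L : language.

Definition card_lt A B (X : set A) (Y : set B) := X #<= Y /\ ~ (Y #<= X).

(* Cardinals are represented by types: [saturated K M] and
   [strongly_homogeneous K M] are kappa-saturation and strong
   kappa-homogeneity for kappa = |K|. *)
Definition saturated (K : Type) (M : structure L) :=
  forall A : set M, card_lt A [set: K] ->
  forall n (p : set (formula L ('I_n + A))), complete_type set_val p ->
  exists b : 'I_n -> M, p `<=` tp (vsum b set_val).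

Definition strongly_homogeneous (K : Type) (M : structure L) :=
  forall (J : Type) (a b : J -> M), card_lt [set: J] [set: K] ->
  tp a = tp b -> exists s : aut M, s \o a = b.

(* kappa > |T|, where |T| is the number of formulas of the language *)
Definition monster_model (T : set (sentence L)) (M : structure L) :=
  models M T /\
  exists K : Type, [/\ card_lt [set: formula L nat] [set: K],
    saturated K M & strongly_homogeneous K M].

(* Repetitions in the enumeration are allowed. *)
Definition enumeration (M : structure L) I (c : I -> M) := range c = setT.

End Monster.

(* The properties of a theory are evaluated in its monster model [M]. *)
Section EmbeddingRamsey.
Variables (L : language) (M : structure L).

Definition binom (C : set M) k (a : 'I_k -> M) : set ('I_k -> M) :=
  [set a' | range a' `<=` C /\ tp a' = tp a].

Definition binom_set (B : set M) : set (set M) :=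
  [set B' | exists s : aut M, B' = s @` B].

(* A coloring of [binom setT a] is represented by a function on all tuples,
   of which only the values on [binom setT a] are ever used. *)
Definition definable_coloring k (a : 'I_k -> M) n
    (c : ('I_k -> M) -> {ffun 'I_n -> bool}) :=
  exists phi : 'I_n -> formula L ('I_k + M),
  forall a', binom setT a a' -> forall i,
    c a' i <-> sat (vsum a' id) (phi i).

(* phi(a, y), for phi(x, y) without parameters, as a formula over [M] *)
Definition plug k Y (a : 'I_k -> M) (phi : formula L ('I_k + Y)) :
    formula L (Y + M) :=
  rename (vsum (inr \o a) inl) phi.

Definition ext_definable_coloring k (a : 'I_k -> M) n
    (c : ('I_k -> M) -> {ffun 'I_n -> bool}) :=
  exists (Y : Type) (phi : 'I_n -> formula L ('I_k + Y))
    (p : 'I_n -> set (formula L (Y + M))),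
  (forall i, types_over M Y (p i)) /\
  forall a', binom setT a a' -> forall i, c a' i <-> p i (plug a' (phi i)).

Definition DEERP :=
  forall (B : set M) k (a : 'I_k -> M) n
    (c : ('I_k -> M) -> {ffun 'I_n -> bool}),
  finite_set B -> range a `<=` B -> definable_coloring a c ->
  exists2 B', binom_set B B' & c @` binom B' a #= `I_1.

Definition EDEERP :=
  forall (B : set M) k (a : 'I_k -> M) n
    (c : ('I_k -> M) -> {ffun 'I_n -> bool}),
  finite_set B -> range a `<=` B -> ext_definable_coloring a c ->
  exists2 B', binom_set B B' & c @` binom B' a #= `I_1.

Variables (I : Type) (cbar : I -> M).

(* The elements of S_cbar(M) *)
Definition in_type_space (p : set (formula L (I + M))) :=
  types_over M I p /\ rename inl @` tp cbar `<=` p.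

Definition ext_definable_Delta_coloring k (a : 'I_k -> M)
    (Delta : set (formula L ('I_k + I))) n
    (c : ('I_k -> M) -> {ffun 'I_n -> bool}) :=
  exists (phi : 'I_n -> formula L ('I_k + I))
    (p : 'I_n -> set (formula L (I + M))),
  [/\ forall i, Delta (phi i), forall i, in_type_space (p i) &
  forall a', binom setT a a' -> forall i, c a' i <-> p i (plug a' (phi i))].

Definition sep_fin_EDEERdeg :=
  forall k (a : 'I_k -> M) (Delta : set (formula L ('I_k + I))),
  finite_set Delta ->
  exists l : nat, forall (B : set M) n
    (c : ('I_k -> M) -> {ffun 'I_n -> bool}),
  finite_set B -> range a `<=` B -> ext_definable_Delta_coloring a Delta c ->
  exists2 B', binom_set B B' & c @` binom B' a #<= `I_l.

End EmbeddingRamsey.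

HB.mixin Record isTopologicalGroup G & Group G & Topological G := {
  mulg_continuous : continuous (fun x : G * G => (x.1 * x.2)%g);
  invg_continuous : continuous (fun x : G => (x^-1)%g) }.

#[short(type="topologicalGroupType")]
HB.structure Definition TopologicalGroup :=
  {G of Group G & Topological G & isTopologicalGroup G}.

Record ambit := Ambit {
  ambit_group : topologicalGroupType;
  ambit_space : topologicalType;
  ambit_act : ambit_group -> ambit_space -> ambit_space;
  ambit_point : ambit_space;
  ambit_compact : compact [set: ambit_space];
  ambit_hausdorff : hausdorff_space ambit_space;
  ambit_zero_dimensional : zero_dimensional ambit_space;
  ambit_act1 : forall x, ambit_act 1%g x = x;
  ambit_actM : forall g h x,
    ambit_act (g * h)%g x = ambit_act g (ambit_act h x);
  ambit_act_continuous : continuous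
    (fun gx : ambit_group * ambit_space => ambit_act gx.1 gx.2);
  ambit_dense : dense (range (ambit_act^~ ambit_point)) }.

Section AmbitRamsey.
Variable A : ambit.
Let G := ambit_group A.
Let X := ambit_space A.

Definition orbit_point : set X := range ((@ambit_act A)^~ (ambit_point A)).

Definition S_definable_coloring (S : set X) (Sigma : set (set X)) n
    (c : G -> {ffun 'I_n -> bool}) :=
  exists (U : 'I_n -> set X) (y : 'I_n -> X),
  [/\ forall i, Sigma (U i), forall i, S (y i) &
  forall g i, c g i <-> (ambit_act g @` U i) (y i)].

Definition RP_for (S : set X) :=
  forall n (c : G -> {ffun 'I_n -> bool}), 0 < n ->
  S_definable_coloring S clopen c ->
  forall F : set G, finite_set F -> F !=set0 ->
  exists h : G, c @` ((fun g => h * g)%g @` F) #= `I_1.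

Definition DRP := RP_for orbit_point.

Definition EDRP := RP_for setT.

Definition sep_fin_EDRdeg :=
  forall Sigma : set (set X), finite_set Sigma -> Sigma `<=` clopen ->
  exists2 l : nat, 0 < l & forall n (c : G -> {ffun 'I_n -> bool}), 0 < n ->
  S_definable_coloring setT Sigma c ->
  forall F : set G, finite_set F -> F !=set0 ->
  exists h : G, c @` ((fun g => h * g)%g @` F) #<= `I_l.

End AmbitRamsey.

Section AutTopology.
Variables (L : language) (M : structure L).
Implicit Types (s t : aut M) (A : set M).

Lemma nbhs_agree s A : finite_set A -> nbhs s (agree s A).
Proof.
move=> fA; rewrite nbhsE /=; exists (agree s A) => //; split => //.
exists [set agree s A]; last by rewrite bigcup_set1.
by move=> _ ->; exists A => //; exists s.
Qed.

Lemma nbhs_aut s (U : set (aut M)) :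
  nbhs s U -> exists2 A, finite_set A & agree s A `<=` U.
Proof.
rewrite nbhsE => -[_ [[D DD <-] [V DV tV]] sU].
have [A fA [t eV]] := DD _ DV; subst V.
exists A => // u us; apply: sU; exists (agree t A) => //.
by move=> m Am /=; rewrite us// tV.
Qed.

Lemma autM_continuous : continuous (fun x : aut M * aut M => (x.1 * x.2)%g).
Proof.
move=> [s t] U /= /nbhs_aut[A fA AU].
exists (agree s (t @` A), agree t A) => /=.
  by split; apply: nbhs_agree => //; exact: finite_image.
move=> [s' t'] [/= ss' tt']; apply: AU => m Am /=.
by rewrite tt'// ss'//; exists m.
Qed.

Lemma autV_continuous : continuous (fun x : aut M => (x^-1)%g).
Proof.
move=> s U /= /nbhs_aut[A fA AU].
apply: filterS (nbhs_agree s (finite_image (aut_inv s) fA)) => t ts.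
apply: AU => m Am /=; rewrite -[in LHS](aut_invK s m) -(ts (aut_inv s m)).
  by rewrite aut_funK.
by exists m.
Qed.

HB.instance Definition _ :=
  isTopologicalGroup.Build (aut M) autM_continuous autV_continuous.

End AutTopology.

Section Renaming.
Variable L : language.

Lemma trename_id V (t : term L V) : trename id t = t.
Proof.
by elim: t => //= f ts IH; congr Tapp; apply/funext => i; rewrite IH.
Qed.

Lemma rename_id V (phi : formula L V) : rename id phi = phi.
Proof.
elim: phi => {V} /=.
- by move=> V t u; rewrite !trename_id.
- by move=> V r ts; congr Frel; apply/funext => i; rewrite trename_id.
- by move=> V phi ->.
- by move=> V phi -> psi ->.
- move=> V phi IH; congr Fex; rewrite -[RHS]IH.
  by congr rename; apply/funext => -[].
Qed.

Lemma trename_comp U V W (f : U -> V) (e : V -> W) (t : term L U) :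
  trename e (trename f t) = trename (e \o f) t.
Proof.
by elim: t => //= g ts IH; congr Tapp; apply/funext => i; rewrite IH.
Qed.

Lemma rename_comp U V W (f : U -> V) (e : V -> W) (phi : formula L U) :
  rename e (rename f phi) = rename (e \o f) phi.
Proof.
elim: phi V W f e => {U} /=.
- by move=> U t u V W f e; rewrite !trename_comp.
- move=> U r ts V W f e; congr Frel; apply/funext => i.
  by rewrite trename_comp.
- by move=> U phi IH V W f e; rewrite IH.
- by move=> U phi IH psi IH' V W f e; rewrite IH IH'.
- move=> U phi IH V W f e; congr Fex; rewrite IH.
  by congr rename; apply/funext => -[].
Qed.

Lemma eval_rename (M : structure L) V W (e : V -> W) (v : W -> M)
  (t : term L V) : eval v (trename e t) = eval (v \o e) t.
Proof.
by elim: t => //= f ts IH; congr fun_interp; apply/funext => i; rewrite IH.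
Qed.

Lemma sat_rename (M : structure L) V W (e : V -> W) (v : W -> M)
  (phi : formula L V) : sat v (rename e phi) = sat (v \o e) phi.
Proof.
elim: phi W e v => {V} /=.
- by move=> V t u W e v; rewrite !eval_rename.
- move=> V r ts W e v; congr rel_interp; apply/funext => i.
  by rewrite eval_rename.
- by move=> V phi IH W e v; rewrite IH.
- by move=> V phi IH psi IH' W e v; rewrite IH IH'.
- move=> V phi IH W e v; apply/propext; split=> -[m mP]; exists m.
  + by move: mP; rewrite IH; congr (sat _ _); apply/funext => -[].
  + by rewrite IH; move: mP; congr (sat _ _); apply/funext => -[].
Qed.

Lemma term_support V (t : term L V) :
  exists (F : finType) (e : F -> V) (u : term L F), t = trename e u.
Proof.
elim: t => [v|f ts IH]; first by exists unit, (fun _ => v), (Tvar L tt).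
pose F i := projT1 (cid (IH i)); pose IH1 i := projT2 (cid (IH i)).
pose e i : F i -> V := projT1 (cid (IH1 i)).
pose IH2 i := projT2 (cid (IH1 i)).
pose u i := projT1 (cid (IH2 i)).
have tsE i : ts i = trename (e i) (u i) := projT2 (cid (IH2 i)).
exists {i : 'I_(fun_arity f) & F i}, (fun x => e (tag x) (tagged x)).
exists (@Tapp L _ f (fun i => trename (fun x => Tagged F x) (u i))) => /=.
by congr Tapp; apply/funext => i; rewrite trename_comp tsE.
Qed.

Lemma formula_support V (phi : formula L V) : inhabited V ->
  exists (F : finType) (e : F -> V) (psi : formula L F), phi = rename e psi.
Proof.
elim: phi => {V}.
- move=> V t u _.
  have [F [e [t' ->]]] := term_support t; have [G [f [u' ->]]] := term_support u.
  exists (F + G)%type, (vsum e f), (Feq (trename inl t') (trename inr u')) => /=.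
  by rewrite !trename_comp.
- move=> V r ts _.
  have IH i := term_support (ts i).
  pose F i := projT1 (cid (IH i)); pose IH1 i := projT2 (cid (IH i)).
  pose e i : F i -> V := projT1 (cid (IH1 i)).
  pose IH2 i := projT2 (cid (IH1 i)).
  pose u i := projT1 (cid (IH2 i)).
  have tsE i : ts i = trename (e i) (u i) := projT2 (cid (IH2 i)).
  exists {i : 'I_(rel_arity r) & F i}, (fun x => e (tag x) (tagged x)).
  exists (@Frel L _ r (fun i => trename (fun x => Tagged F x) (u i))) => /=.
  by congr Frel; apply/funext => i; rewrite trename_comp tsE.
- by move=> V phi IH /IH[F [e [psi ->]]]; exists F, e, (Fnot psi).
- move=> V phi IH phi' IH' iV.
  have [F [e [psi ->]]] := IH iV; have [G [f [psi' ->]]] := IH' iV.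
  exists (F + G)%type, (vsum e f), (Fand (rename inl psi) (rename inr psi')).
  by rewrite /= !rename_comp.
- move=> V phi IH [v].
  have [F [e [psi ->]]] := IH (inhabits None).
  exists F, (fun x => odflt v (e x)).
  exists (Fex (rename (fun x => omap (fun=> x) (e x)) psi)) => /=.
  congr Fex; rewrite rename_comp; congr rename; apply/funext => x /=.
  by case ex: (e x) => [y|] //=; rewrite ex.
Qed.

End Renaming.

Section CompleteTypes.
Variables (L : language) (M : structure L) (V P : Type) (e : P -> M).
Variable p : set (formula L (V + P)).
Hypothesis p_complete : complete_type e p.

Lemma complete_type_sat (s : seq (formula L (V + P))) :
  [set` s] `<=` p -> exists v : V -> M, [set` s] `<=` tp (vsum v e).
Proof. by apply: (proj1 p_complete); apply/finite_seqP; exists s. Qed.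

Lemma complete_typeN phi : p (Fnot phi) <-> ~ p phi.
Proof.
split=> [pN pphi|np]; last by case: (proj2 p_complete phi).
have [|v sv] := @complete_type_sat [:: phi; Fnot phi].
  by move=> psi /=; rewrite !inE => /orP[] /eqP ->.
have := sv (Fnot phi); rewrite /= /tp /= !inE eqxx orbT => /(_ isT); apply.
by have := sv phi; rewrite /= !inE eqxx => /(_ isT).
Qed.

Lemma complete_type_entail (s : seq (formula L (V + P))) phi :
  [set` s] `<=` p ->
  (forall v : V -> M, [set` s] `<=` tp (vsum v e) -> sat (vsum v e) phi) ->
  p phi.
Proof.
move=> sp sphi; apply: contrapT => /complete_typeN pN.
have [|v sv] := @complete_type_sat (Fnot phi :: s).
  by move=> psi /=; rewrite inE => /orP[/eqP ->//|/sp].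
have : tp (vsum v e) (Fnot phi) by apply: sv; rewrite /= inE eqxx.
by apply; apply: sphi => psi psis; apply: sv; rewrite /= inE; apply/orP; right.
Qed.

Lemma complete_typeI phi psi : p (Fand phi psi) <-> p phi /\ p psi.
Proof.
have tp2 chi (v : V -> M) (s : seq (formula L (V + P))) :
  [set` s] `<=` tp (vsum v e) -> chi \in s -> sat (vsum v e) chi.
  by move=> sv chis; exact: sv.
split=> [pI|[pp pq]].
  split; apply: (@complete_type_entail [:: Fand phi psi]).
  - by move=> chi /=; rewrite inE => /eqP ->.
  - by move=> v /(_ (Fand phi psi)); rewrite /= inE eqxx => /(_ isT) [].
  - by move=> chi /=; rewrite inE => /eqP ->.
  - by move=> v /(_ (Fand phi psi)); rewrite /= inE eqxx => /(_ isT) [].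
apply: (@complete_type_entail [:: phi; psi]).
  by move=> chi /=; rewrite !inE => /orP[] /eqP ->.
by move=> v sv; split; apply: (tp2 _ _ _ sv); rewrite !inE eqxx ?orbT.
Qed.

End CompleteTypes.

Section TypeSpace.
Variables (L : language) (M : structure L) (I : Type) (cbar : I -> M).

Definition type_space := {p | in_type_space cbar p}.

HB.instance Definition _ := gen_eqMixin type_space.
HB.instance Definition _ := gen_choiceMixin type_space.

Implicit Types (p q : type_space) (phi psi : formula L (I + M)).

Lemma type_spaceP p : complete_type id (sval p).
Proof. by have [] := svalP p. Qed.

Lemma type_space_ext p q : (forall phi, sval p phi -> sval q phi) -> p = q.
Proof.
move=> pq; suff : sval p = sval q.
  by case: p q {pq} => [p hp] [q hq] /=; exact: eq_exist.
apply/seteqP; split=> // phi qphi.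
apply: contrapT => /(complete_typeN (type_spaceP p)) /pq.
by move=> /(complete_typeN (type_spaceP q)).
Qed.

(* The basic clopen set [phi] *)
Definition type_box phi : set type_space := [set p | sval p phi].

Definition type_basic : set (set type_space) := range type_box.

Lemma type_boxC phi : type_box (Fnot phi) = ~` type_box phi.
Proof.
apply/seteqP; split=> p; first by move/(complete_typeN (type_spaceP p)).
by move=> /= /(complete_typeN (type_spaceP p)).
Qed.

Lemma type_boxI phi psi :
  type_box (Fand phi psi) = type_box phi `&` type_box psi.
Proof.
by apply/seteqP; split=> p; move/(complete_typeI (type_spaceP p)).
Qed.

Lemma type_boxT : type_box (Ftrue L _) = setT.
Proof.
apply/seteqP; split=> // p _.
apply: (complete_type_entail (type_spaceP p) (s := [::])) => //.
by have [m] := carrier_inhabited M; exists m.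
Qed.

Lemma type_basic_cover : \bigcup_(U in type_basic) id U = setT.
Proof.
apply/seteqP; split=> // p _; exists setT => //.
by exists (Ftrue L _) => //; rewrite type_boxT.
Qed.

Lemma type_basic_join (U W : set type_space) p : type_basic U ->
  type_basic W -> id U p -> id W p ->
  exists Z, [/\ type_basic Z, id Z p & id Z `<=` id U `&` id W].
Proof.
move=> [phi _ <-] [psi _ <-] pp pq.
exists (type_box (Fand phi psi)); split; first by exists (Fand phi psi).
  by rewrite type_boxI.
by rewrite type_boxI.
Qed.

HB.instance Definition _ :=
  isBaseTopological.Build type_space type_basic_cover type_basic_join.

Lemma type_box_open phi : open (type_box phi).
Proof.
exists [set type_box phi]; last by rewrite bigcup_set1.
by move=> _ ->; exists phi.
Qed.

Lemma type_box_clopen phi : clopen (type_box phi).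
Proof.
split; first exact: type_box_open.
by rewrite -[type_box phi]setCK -type_boxC; exact/open_closedC/type_box_open.
Qed.

Lemma nbhs_type_space p (U : set type_space) : nbhs p U ->
  exists2 phi, sval p phi & type_box phi `<=` U.
Proof.
rewrite nbhsE => -[_ [[D DD <-] [W DW pW]] sU].
have [phi _ eW] := DD _ DW; subst W.
by exists phi => // q pq; apply: sU; exists (type_box phi).
Qed.

Lemma type_space_zero_dimensional : zero_dimensional type_space.
Proof.
move=> p q /eqP pq.
have [phi [pphi qphi]] : exists phi, sval p phi /\ ~ sval q phi.
  apply: contrapT => npq; apply: pq; apply: type_space_ext => phi pphi.
  by apply: contrapT => nq; apply: npq; exists phi.
by exists (type_box phi); split => //; exact: type_box_clopen.
Qed.

Lemma type_space_hausdorff : hausdorff_space type_space.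
Proof.
move=> p q pq; apply: contrapT => /eqP npq.
have [U [[oU cU] Up Uq]] := type_space_zero_dimensional npq.
have /(_ U (~` U)) := pq; case.
- by apply: open_nbhs_nbhs.
- by apply: open_nbhs_nbhs; split => //; exact: closed_openC.
- by move=> r [].
Qed.

Lemma type_space_compact : compact [set: type_space].
Proof.
rewrite compact_ultra => F UF _.
pose P := [set phi | F (type_box phi)].
have Pcap (s : seq (formula L (I + M))) : [set` s] `<=` P ->
    F [set p : type_space | [set` s] `<=` sval p].
  elim: s => [_|phi s IH sP].
    by rewrite (_ : [set _ | _] = setT); [exact: filterT|apply/seteqP; split].
  have : F (type_box phi `&` [set p : type_space | [set` s] `<=` sval p]).
    apply: filterI; first by apply: sP; rewrite /= inE eqxx.
    by apply: IH => psi psis; apply: sP; rewrite /= inE; apply/orP; right.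
  apply: filterS => p [pphi ps] psi /=; rewrite inE => /orP[/eqP -> //|].
  exact: ps.
have Pc : complete_type id P.
  split=> [_ /finite_seqP[s ->] sP|phi].
    have [p sp] := filter_ex (Pcap s sP).
    exact: complete_type_sat (type_spaceP p) s sp.
  have [|] := in_ultra_setVsetC (type_box phi) UF; first by left.
  by rewrite -type_boxC; right.
have Ps : in_type_space cbar P.
  split=> // _ [phi cphi <-].
  rewrite /P /= (_ : type_box _ = setT); first exact: filterT.
  apply/seteqP; split=> // p _; have [_] := svalP p.
  by apply; exists phi.
exists (exist _ P Ps); split => //.
by move=> U /nbhs_type_space[phi Pphi sU]; exact: filterS sU Pphi.
Qed.

End TypeSpace.

Section TypeAmbit.
Variables (L : language) (M : structure L) (I : Type) (cbar : I -> M).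
Implicit Types (s t : aut M) (p q : type_space cbar).

Lemma eval_aut s V (v : V -> M) (u : term L V) :
  eval (s \o v) u = s (eval v u).
Proof.
by elim: u => //= f ts IH; rewrite aut_funs; congr fun_interp; apply/funext.
Qed.

Lemma sat_aut s V (v : V -> M) (phi : formula L V) :
  sat (s \o v) phi = sat v phi.
Proof.
elim: phi s v => {V} /=.
- move=> V t u s v; rewrite !eval_aut; apply/propext; split=> [|-> //].
  exact/can_inj/aut_funK.
- move=> V r ts s v; apply/propext.
  apply: iff_trans (aut_rels s _).
  suff -> : (fun i => eval (s \o v) (ts i)) = s \o (fun i => eval v (ts i)) by [].
  by apply/funext => i; rewrite eval_aut.
- by move=> V phi IH s v; rewrite IH.
- by move=> V phi IH psi IH' s v; rewrite IH IH'.
- move=> V phi IH s v.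
  have E m : oapp (s \o v) (s m) = s \o oapp v m by apply/funext => -[].
  apply/propext; split=> -[m mP].
    exists (aut_inv s m); rewrite -(IH s) -E aut_invK.
    exact: mP.
  by exists (s m); rewrite E IH.
Qed.

(* [s] acts on a formula over [M] by moving its parameters. *)
Definition move_params s : formula L (I + M) -> formula L (I + M) :=
  rename (vsum inl (inr \o s)).

Lemma move_params1 phi : move_params 1%g phi = phi.
Proof.
rewrite /move_params -[RHS]rename_id; congr rename.
by apply/funext => -[].
Qed.

Lemma move_paramsM s t phi :
  move_params (s * t)%g phi = move_params s (move_params t phi).
Proof.
by rewrite /move_params rename_comp; congr rename; apply/funext => -[].
Qed.

Lemma move_params_image s (p : set (formula L (I + M))) phi :
  (move_params s @` p) phi <-> p (move_params s^-1%g phi).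
Proof.
split=> [[psi ppsi <-]|pphi].
  by rewrite -move_paramsM mulVg move_params1.
by exists (move_params s^-1%g phi) => //; rewrite -move_paramsM mulgV move_params1.
Qed.

Lemma sat_move_params s (v : I -> M) phi :
  sat (vsum (s \o v) id) (move_params s phi) = sat (vsum v id) phi.
Proof.
rewrite sat_rename -(sat_aut s (vsum v id)); congr sat.
by apply/funext => -[].
Qed.

Lemma move_params_in_type_space s (p : set (formula L (I + M))) :
  in_type_space cbar p -> in_type_space cbar (move_params s @` p).
Proof.
move=> [[pfs pc] pcbar]; split; first split.
- move=> F fF Fp.
  have [|psi [phi Fphi <-]|v vF] := pfs (move_params s^-1%g @` F).
  + exact: finite_image.
  + by apply/move_params_image/Fp.
  exists (s \o v) => phi Fphi.
  rewrite /tp /= -[phi]move_params1 -(mulgV s) move_paramsM sat_move_params.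
  by apply: vF; exists phi.
- move=> phi; have [pp|pp] := pc (move_params s^-1%g phi).
    by left; apply/move_params_image.
  by right; apply/move_params_image.
- move=> _ [phi cphi <-]; apply/move_params_image.
  have -> : move_params s^-1%g (rename inl phi) = rename inl phi.
    by rewrite /move_params rename_comp; congr rename; apply/funext.
  by apply: pcbar; exists phi.
Qed.

Definition type_act s p : type_space cbar :=
  exist _ _ (move_params_in_type_space s (svalP p)).

Lemma type_actE s p phi :
  sval (type_act s p) phi <-> sval p (move_params s^-1%g phi).
Proof. exact: move_params_image. Qed.

Lemma type_act1 p : type_act 1%g p = p.
Proof.
apply: type_space_ext => phi /type_actE.
by rewrite invg1 move_params1.
Qed.

Lemma type_actM s t p : type_act (s * t)%g p = type_act s (type_act t p).
Proof.
apply: type_space_ext => phi /type_actE.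
rewrite invgM move_paramsM => pphi; apply/type_actE.
by apply/type_actE.
Qed.

Lemma tp_cbar_in_type_space : in_type_space cbar (tp (vsum cbar id)).
Proof.
split; first split.
- by move=> F _ Fp; exists cbar.
- by move=> phi; exact: EM.
- by move=> _ [phi cphi <-]; rewrite /tp /= sat_rename.
Qed.

(* tp(cbar / M) *)
Definition type_point : type_space cbar := exist _ _ tp_cbar_in_type_space.

Lemma type_act_continuous :
  continuous (fun x : aut M * type_space cbar => type_act x.1 x.2).
Proof.
move=> [s p] U /= /nbhs_type_space[phi /type_actE pphi phiU].
have [F [e [psi phiE]]] : exists (F : finType) (e : F -> I + M) psi,
    phi = rename e psi.
  apply: formula_support.
  by have [m] := carrier_inhabited M; exists; right.
pose A := [set m | exists x, e x = inr m].
have fA : finite_set A.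
  have [m0] := carrier_inhabited M.
  apply: (@sub_finite_set _ _
    ((fun x => if e x is inr m then m else m0) @` [set: F])).
    by move=> m [x ex]; exists x => //; rewrite ex.
  exact/finite_image/finite_finset.
pose phi' := move_params s^-1%g phi.
exists (agree s (aut_inv s @` A), type_box phi').
  split => /=; first exact/nbhs_agree/finite_image.
  by apply: open_nbhs_nbhs; split => //; exact: type_box_open.
move=> [t q] [/= ts qphi]; apply: phiU; apply/type_actE => /=.
suff -> : move_params t^-1%g phi = phi' by [].
rewrite /phi' /move_params phiE !rename_comp; congr rename; apply/funext => x.
rewrite /=; case ex: (e x) => [i|m] //=; congr inr.
rewrite -[in LHS](aut_invK s m) -ts ?aut_funK//.
by exists m => //; exists x.
Qed.

Section Density.
Variable T : set (sentence L).
Hypothesis monsterM : monster_model T M.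

Lemma card_lt_finite K J (A : set J) :
  card_lt [set: formula L nat] [set: K] -> finite_set A ->
  card_lt A [set: K].
Proof.
move=> [LK _] fA.
have natK : [set: nat] #<= [set: K].
  apply: card_le_trans LK; apply/pcard_injP.
  exists (fun n => iter n (@Fnot L nat) (Ftrue L nat)) => m n _ _.
  elim: m n => [|m IH] [|n] //= [] /IH -> //.
split; first exact: card_le_trans (finite_set_countable fA) natK.
move=> KA; have : finite_set [set: nat].
  exact: card_le_finite (card_le_trans natK KA) fA.
exact: infinite_nat.
Qed.

Lemma type_orbit_dense : dense (range (type_act^~ type_point)).
Proof.
move=> U [p Up] oU.
have [phi pphi phiU] : exists2 phi, sval p phi & type_box phi `<=` U.
  by apply: nbhs_type_space; exact: open_nbhs_nbhs.
have [F [e [psi phiE]]] : exists (F : finType) (e : F -> I + M) psi,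
    phi = rename e psi.
  apply: formula_support.
  by have [m] := carrier_inhabited M; exists; right.
have [_ [K [LK satK homK]]] := monsterM.
pose A := [set m | exists x, e x = inr m].
have fA : finite_set A.
  have [m0] := carrier_inhabited M.
  apply: (@sub_finite_set _ _
    ((fun x => if e x is inr m then m else m0) @` [set: F])).
    by move=> m [x ex]; exists x => //; rewrite ex.
  exact/finite_image/finite_finset.
pose isl x := if e x is inl _ then true else false.
pose V : finType := {x : F | isl x}.
have /choice[eV eVE] : forall x : V, exists i, e (sval x) = inl i.
  by case=> x /=; rewrite /isl; case: (e x) => // i; exists i.
pose h (x : V + A) : I + M := vsum (inl \o eV) (inr \o set_val) x.
have [psi' psi'E] : exists psi', phi = rename h psi'.
  have /choice[g gE] : forall x : F, exists y : V + A, h y = e x.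
    move=> x; case ex: (e x) => [i|m].
      have xV : isl x by rewrite /isl ex.
      by exists (inl (exist _ x xV)); rewrite /h /= -eVE /= ex.
    have mA : A m by exists x.
    by exists (inr (SigSub (mem_set mA))).
  exists (rename g psi); rewrite phiE rename_comp; congr rename.
  by apply/funext => x /=; rewrite gE.
pose r (y : 'I_#|{: V}| + A) : V + A := vsum (inl \o enum_val) inr y.
pose q := [set chi : formula L ('I_#|{: V}| + A) | sval p (rename (h \o r) chi)].
have qc : complete_type set_val q.
  have [pfs pc] := type_spaceP p; split=> [s fs sq|chi]; last exact: pc.
  have [|_ [chi schi <-]|v sv] := pfs (rename (h \o r) @` s).
  - exact: finite_image.
  - exact: sq.
  exists (v \o eV \o enum_val) => chi schi.
  have /sv : (rename (h \o r) @` s) (rename (h \o r) chi) by exists chi.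
  rewrite /tp /= sat_rename; congr sat.
  by apply/funext => -[].
have [b qb] := satK A (card_lt_finite LK fA) _ q qc.
have btp : tp (cbar \o eV \o enum_val) = tp b.
  have sub (chi : formula L 'I_#|{: V}|) :
      sat (cbar \o eV \o enum_val) chi -> sat b chi.
    move=> cchi; have : q (rename inl chi).
      rewrite /q /= rename_comp; have [_ ] := svalP p; apply.
      exists (rename (eV \o enum_val) chi); first by rewrite /tp /= sat_rename.
      by rewrite rename_comp.
    by move/qb; rewrite /tp /= sat_rename.
  apply/seteqP; split=> chi; first exact: sub.
  by move=> bchi; apply: contrapT => /(sub (Fnot chi)).
have [|s sb] := homK _ _ _ _ btp.
  by apply: card_lt_finite => //; exact: finite_finset.
exists (type_act s type_point); split; last by exists s.
apply: phiU.
suff : sval type_point (move_params s^-1%g phi) by move/type_actE.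
rewrite /= /tp /= -(sat_move_params s) -move_paramsM mulgV move_params1.
rewrite psi'E sat_rename.
pose r' (y : V + A) : 'I_#|{: V}| + A := vsum (inl \o enum_rank) inr y.
have rr' : r \o r' = id by apply/funext => -[x|x] //=; rewrite enum_rankK.
have : q (rename r' psi').
  by rewrite /q /= rename_comp -compA rr' -psi'E.
move/qb; rewrite /tp /= sat_rename; congr sat.
apply/funext => -[x|x] //=.
have := congr1 (fun f => f (enum_rank x)) sb.
by rewrite /= enum_rankK => ->.
Qed.

Definition type_ambit : ambit := @Ambit (aut M) (type_space cbar)
  type_act type_point (@type_space_compact _ _ _ _)
  (@type_space_hausdorff _ _ _ _) (@type_space_zero_dimensional _ _ _ _)
  type_act1 type_actM type_act_continuous type_orbit_dense.

End Density.
End TypeAmbit.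

(* Main.v *)
Require Import Defs.
From mathcomp Require Import all_boot.
From mathcomp Require Import all_classical topology.

Set Implicit Arguments.
Unset Strict Implicit.
Unset Printing Implicit Defensive.

Local Open Scope classical_set_scope.
Local Open Scope card_scope.

(**
Colorings of the copies of a finite tuple a and colorings of G = Aut(M) are
related by restriction along the orbit map g |-> g o a.  Strong homogeneity
makes this map onto the set of copies of a in M.

Definability matches along the orbit map.  A clopen set of S_cbar(M) is a box
[psi(y)], with psi over M, and psi has the form phi(a, y) for a finite tuple a
of parameters and phi without parameters.  Moving parameters,
  p is in g [phi(a, y)]  iff  phi(g a, y) is in p,
so the coloring of G given by boxes [phi_i(a, y)] and types p_i is the coloring
of copies a' of a given by phi_i and p_i, read at a' = g a.  This is
[type_coloring_to_group] and [type_coloring_of_group].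

Finite configurations match as well.  For a in a finite set B, the copies of a
inside B are finitely many, so they are the g a for g in some finite F, and
then the copies inside h B are the (h g) a, with g in F.  Conversely, for a
finite F, the g a with g in F all lie in one finite set.  Hence h B sees the
same colors as h F.

It remains to see that the colorings of each kind are those given by formulas
phi_i(x, y), with y of the length of cbar, and by types p_i in the relevant
part of S_cbar(M) ([type_coloring]).  Parameters in a definable coloring are
entries of cbar, so definable colorings are those with p_i = tp(cbar / M), and
also those with p_i in the orbit of that type, which consists of the types
tp(s cbar / M).  For externally definable colorings, the point is to replace a
type p(z) in arbitrary variables by one in S_cbar(M).  Only finitely many
variables z occur in the given formula; by saturation the restriction of p to
the empty set is realized by entries of cbar, say with indices j, and then the
formulas chi(y_j) for chi in p are consistent with tp(cbar) by homogeneity, so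
they are contained in a type of S_cbar(M) by compactness
([types_over_transport]).
*)

(** * Finite sets *)

Section FiniteSets.

Lemma finite_set_rangeP T (B : set T) :
  finite_set B -> exists N (e : 'I_N -> T), B = range e.
Proof.
move=> /(@finite_seqP {classic T})[s ->].
exists (size s), (tnth (in_tuple s)).
apply/seteqP; split=> [x /= /(tnthP (in_tuple s))[i ->]|_ [i _ <-]].
  by exists i.
exact: mem_tnth.
Qed.

Lemma card_eq1_nonempty T (A : set T) : A !=set0 -> (A #= `I_1) = (A #<= `I_1).
Proof.
move=> [x Ax]; rewrite card_eq_le andb_idr// => _.
apply: (@card_le_trans _ _ _ [set x]); last by apply: subset_card_le => _ ->.
by have := @card_set1 T x; rewrite card_eq_le => /andP[].
Qed.

End FiniteSets.

(** * Separating the parameters of a formula *)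

Section FormulaSupport.
Variable L : language.

(** A formula mentions finitely many of the variables in [W]; those in [V] are
    left alone, so that the result has the shape that [plug] consumes. *)
Lemma formula_support_right V W (phi : formula L (V + W)) :
  exists l (b : 'I_l -> W) (theta : formula L (V + 'I_l)),
    phi = rename (vsum inl (inr \o b)) theta.
Proof.
have [F [e [psi ->]]] : exists (F : finType) (e : F -> V + W) psi,
    phi = rename e psi.
  (* With no variables at all the formula is a sentence. *)
  have [iVW|nVW] := EM (inhabited (V + W)); first exact: formula_support.
  exists void, (of_void _), (rename (fun x => False_rect _ (nVW (inhabits x))) phi).
  rewrite rename_comp -[LHS]rename_id; congr rename; apply/funext => x.
  by case: (nVW (inhabits x)).
pose isr x := if e x is inr _ then true else false.
pose J : finType := {x : F | isr x}.
have /choice[d dE] : forall x : J, exists w, e (sval x) = inr w.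
  by case=> x /=; rewrite /isr; case: (e x) => // w; exists w.
have /choice[g gE] : forall x : F, exists y : V + 'I_#|{: J}|,
    vsum inl (inr \o (d \o enum_val)) y = e x.
  move=> x; case ex: (e x) => [v|w]; first by exists (inl v).
  have xJ : isr x by rewrite /isr ex.
  exists (inr (enum_rank (exist _ x xJ : J))).
  by rewrite /= enum_rankK -dE.
exists #|{: J}|, (d \o enum_val), (rename g psi).
by rewrite rename_comp; congr rename; apply/funext => x /=; rewrite gE.
Qed.

(** One tuple [a] serves a whole finite family: concatenate the tuples of
    parameters of its members. *)
Lemma plug_family (M : structure L) I (J : finType)
    (psi : J -> formula L (I + M)) :
  exists k (a : 'I_k -> M) (theta : J -> formula L ('I_k + I)),
    forall j, psi j = plug a (theta j).
Proof.
have /choice[x xE] : forall j, exists x : {l : nat &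
    (('I_l -> M) * formula L (I + 'I_l))%type},
    psi j = rename (vsum inl (inr \o (tagged x).1)) (tagged x).2.
  move=> j; have [l [b [theta ->]]] := formula_support_right (psi j).
  by exists (Tagged (fun l => (('I_l -> M) * formula L (I + 'I_l))%type)
    (b, theta)).
pose K : finType := {j : J & 'I_(tag (x j))}.
pose a (u : K) : M := (tagged (x (tag u))).1 (tagged u).
pose r j (t : 'I_(tag (x j))) : 'I_#|{: K}| :=
  enum_rank (Tagged (fun j => 'I_(tag (x j))) t).
exists #|{: K}|, (a \o enum_val),
  (fun j => rename (vsum inr (inl \o @r j)) (tagged (x j)).2) => j.
rewrite {1}xE /plug rename_comp; congr rename; apply/funext => -[i|t] //=.
by rewrite /r enum_rankK.
Qed.

End FormulaSupport.

(** * Boxes and compactness *)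

Section TypeSpaceTopology.
Variables (L : language) (M : structure L) (I : Type) (cbar : I -> M).

(** Compactness, in the form in which types are constructed: the boxes of the
    formulas in [D] form a filter base, a cluster point of which lies in all of
    them because boxes are closed. *)
Lemma type_space_inhabited_fip (D : set (formula L (I + M))) :
  D !=set0 -> (forall phi psi, D phi -> D psi -> D (Fand phi psi)) ->
  (forall phi, D phi -> @type_box _ _ _ cbar phi !=set0) ->
  exists q : type_space cbar, D `<=` sval q.
Proof.
move=> [phi0 D0] DI Dne.
pose F := [set W | exists2 phi, D phi & @type_box _ _ _ cbar phi `<=` W].
have FF : ProperFilter F.
  split; first by move=> [phi /Dne[q qphi] /(_ _ qphi)].
  split; first by exists phi0.
  - move=> U W [phi Dphi phiU] [psi Dpsi psiW].
    exists (Fand phi psi); first exact: DI.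
    by rewrite type_boxI => q [/phiU ? /psiW ?].
  - by move=> U W UW [phi Dphi phiU]; exists phi => // q /phiU /UW.
have [|q [_ clq]] := @type_space_compact _ _ _ cbar F FF.
  by exists phi0.
exists q => phi Dphi; apply: contrapT => nq.
have [|//|r [rphi]] := clq (type_box phi) (type_box (Fnot phi)).
- by exists phi.
- apply: open_nbhs_nbhs; split; first exact: type_box_open.
  exact/(complete_typeN (type_spaceP q)).
- by rewrite type_boxC.
Qed.

(** Boxes are closed under finite unions, and a clopen set is compact and a
    union of boxes.  Here: if [U] is not a box, then [U] minus a box inside [U]
    is never empty, and compactness gives a point that is in no box inside [U]
    and in no box outside [U]. *)
Lemma type_clopen_box (U : set (type_space cbar)) :
  clopen U -> exists phi, U = type_box phi.
Proof.
move=> [oU cU]; apply: contrapT => nU.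
pose F0 : formula L (I + M) := Fnot (Ftrue L _).
have F0E : @type_box _ _ _ cbar F0 = set0 by rewrite type_boxC type_boxT setCT.
(* The boxes of [D] are those that cover [U] up to a box inside [U]. *)
pose D := [set phi | exists psi, @type_box _ _ _ cbar psi `<=` U /\
  U `<=` type_box phi `|` type_box psi].
have [|||q Dq] := @type_space_inhabited_fip D.
- by exists (Ftrue L _), F0; rewrite F0E type_boxT; split=> // q _; left.
- move=> phi psi [phi' [phi'U Uphi]] [psi' [psi'U Upsi]].
  (* The formula below is the disjunction of [phi'] and [psi']. *)
  exists (Fnot (Fand (Fnot phi') (Fnot psi'))).
  rewrite !(type_boxC, type_boxI) setCI !setCK.
  split=> q; first by case=> [/phi'U|/psi'U].
  move=> Uq; have [pq|] := Uphi q Uq; last by right; left.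
  by have [|] := Upsi q Uq; [left|right; right].
- move=> phi [psi [psiU Uphi]]; apply/set0P/eqP => phi0; apply: nU.
  by exists psi; apply/seteqP; split=> // q /Uphi[]//; rewrite phi0.
have [Uq|nUq] := EM (U q).
  have [psi qpsi psiU] := nbhs_type_space (open_nbhs_nbhs (conj oU Uq)).
  have : D (Fnot psi).
    by exists psi; split=> // r _; rewrite type_boxC setvU.
  by move=> /Dq /(complete_typeN (type_spaceP q)).
have oCU : open (~` U) by exact: closed_openC.
have [psi qpsi psiU] := nbhs_type_space (open_nbhs_nbhs (conj oCU nUq)).
have : D (Fnot psi).
  exists F0; rewrite F0E; split=> // r Ur; left.
  by rewrite type_boxC => /psiU.
by move=> /Dq /(complete_typeN (type_spaceP q)).
Qed.

End TypeSpaceTopology.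

(** * The action on types *)

Section TypeAction.
Variables (L : language) (M : structure L) (I : Type) (cbar : I -> M).
Implicit Types (s g : aut M) (p : type_space cbar).

Lemma tp_aut s V (v : V -> M) : tp (s \o v) = tp v.
Proof. by apply/seteqP; split=> phi; rewrite /tp /= sat_aut. Qed.

Lemma type_act_box g phi p :
  (type_act g @` type_box phi) p <-> sval p (move_params g phi).
Proof.
split=> [[q qphi <-]|pphi].
  by apply/type_actE; rewrite -move_paramsM mulVg move_params1.
exists (type_act g^-1%g p); first by apply/type_actE; rewrite invgK.
by rewrite -type_actM mulgV type_act1.
Qed.

Lemma move_params_plug g k (a : 'I_k -> M) (theta : formula L ('I_k + I)) :
  move_params g (plug a theta) = plug (g \o a) theta.
Proof.
by rewrite /move_params /plug rename_comp; congr rename; apply/funext => -[].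
Qed.

Lemma sat_plug k (a : 'I_k -> M) Y (b : Y -> M) (theta : formula L ('I_k + Y)) :
  sat (vsum b id) (plug a theta) = sat (vsum a b) theta.
Proof. by rewrite sat_rename; congr sat; apply/funext => -[]. Qed.

(** The translate by [s] of tp(cbar/M) is tp(s cbar/M). *)
Lemma type_act_pointE s phi :
  sval (type_act s (type_point cbar)) phi <-> sat (vsum (s \o cbar) id) phi.
Proof.
apply: iff_trans (type_actE _ _ _) _.
by rewrite /= /tp /= -(sat_move_params s) -move_paramsM mulgV move_params1.
Qed.

End TypeAction.

(** * Types realized in the monster model *)

Lemma complete_type_pull L (M : structure L) V W P Q (e : P -> M) (p : set (formula L (V + P)))
    (b : W -> V) (f : Q -> P) :
  complete_type e p ->
  complete_type (e \o f) [set chi | p (rename (vsum (inl \o b) (inr \o f)) chi)].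
Proof.
move=> [pfs pc]; split=> [s fs sp|chi]; last exact: pc.
have [|_ [chi schi <-]|v sv] :=
  pfs (rename (vsum (inl \o b) (inr \o f)) @` s).
- exact: finite_image.
- exact: sp.
exists (v \o b) => chi schi.
have /sv : (rename (vsum (inl \o b) (inr \o f)) @` s)
  (rename (vsum (inl \o b) (inr \o f)) chi) by exists chi.
by rewrite /tp /= sat_rename; congr sat; apply/funext => -[].
Qed.

Section Monster.
Variables (L : language) (T : set (sentence L)) (M : structure L).
Hypothesis hM : monster_model T M.

Lemma finite_homogeneous k (a b : 'I_k -> M) :
  tp a = tp b -> exists s : aut M, s \o a = b.
Proof.
move=> ab; have [_ [K [LK _ homK]]] := hM.
by apply: homK ab; apply: card_lt_finite LK _; exact: finite_finset.
Qed.

(** Saturation is applied to the restriction of [p] to the finitely many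
    parameters of [chi]; it contains the part of [p] without parameters. *)
Lemma types_over_realize l (p : set (formula L ('I_l + M)))
    (chi : formula L ('I_l + M)) : types_over M 'I_l p -> p chi ->
  exists2 d : 'I_l -> M, sat (vsum d id) chi & tp d = [set phi | p (rename inl phi)].
Proof.
move=> pc pchi; have [_ [K [LK satK _]]] := hM.
have [k [m [theta chiE]]] := formula_support_right chi.
have fA : finite_set (range m) by exact/finite_image/finite_finset.
have qc : complete_type (set_val : range m -> M) _ :=
  complete_type_pull id (set_val : range m -> M) pc.
have [d qd] := satK _ (card_lt_finite LK fA) _ _ qc.
have m' i : range m (m i) by exists i.
pose r := vsum (inl : 'I_l -> 'I_l + range m)
  (fun i : 'I_k => inr (SigSub (mem_set (m' i)))).
have rE : vsum (inl \o id) (inr \o set_val) \o r = vsum inl (inr \o m).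
  by apply/funext => -[].
exists d.
  have /qd : p (rename (vsum (inl \o id) (inr \o set_val)) (rename r theta)).
    by rewrite rename_comp rE -chiE.
  rewrite /tp /= chiE !sat_rename; congr sat; apply/funext => -[] //.
have sub phi : p (rename inl phi) -> tp d phi.
  move=> pphi.
  have /qd : p (rename (vsum (inl \o id) (inr \o (set_val : range m -> M))) (rename inl phi)).
    rewrite rename_comp; congr p: pphi.
  by rewrite /tp /= sat_rename.
apply/seteqP; split=> phi; last exact: sub.
move=> dphi; apply: contrapT => /= /(complete_typeN pc).
by move=> /(sub (Fnot phi)).
Qed.

Variables (I : Type) (cbar : I -> M).
Hypothesis hc : enumeration cbar.

Lemma enumeration_section : exists j : M -> I, cancel j cbar.
Proof.
have /choice[j jK] : forall m, exists i, cbar i = m.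
  by move=> m; have [i _ <-] : range cbar m; [rewrite hc|exists i].
by exists j.
Qed.

(** A type in finitely many variables is induced by one in S_cbar(M).  Take the
    indices [j] of a realization in M of its restriction to the empty set. *)
Lemma types_over_transport l (p : set (formula L ('I_l + M))) :
  types_over M 'I_l p -> exists (j : 'I_l -> I) (q : type_space cbar),
    forall chi, p chi <-> sval q (rename (vsum (inl \o j) inr) chi).
Proof.
move=> pc; have [sec secK] := enumeration_section.
have pT : p (Ftrue L _).
  apply: (complete_type_entail pc (s := [::])) => // v _.
  by have [m] := carrier_inhabited M; exists m.
have [b _ tpb] := types_over_realize pc pT.
pose r := rename (vsum (inl \o (sec \o b)) inr) : formula L ('I_l + M) -> formula L (I + M).
have [|||q qP] := @type_space_inhabited_fip _ _ _ cbar (r @` p).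
- by exists (r (Ftrue L _)), (Ftrue L _).
- move=> _ _ [phi pphi <-] [psi ppsi <-]; exists (Fand phi psi) => //.
  exact/(complete_typeI pc).
- move=> _ [chi pchi <-].
  have [d dchi tpd] := types_over_realize pc pchi.
  (* [chi] is realized by some [d] with the type of [b]; if [s b = d], then
     [s cbar] realizes [chi] in the variables indexed by [j]. *)
  have [s sb] := finite_homogeneous (etrans tpb (esym tpd)).
  exists (type_act s (type_point cbar)); apply/type_act_pointE.
  rewrite /r sat_rename; congr sat: dchi; apply/funext => -[i|] //=.
  by rewrite secK -sb.
exists (sec \o b), q => chi; split=> [pchi|qchi]; first by apply: qP; exists chi.
apply: contrapT => /(complete_typeN pc) pN.
have : sval q (r (Fnot chi)) by apply: qP; exists (Fnot chi).
by move=> /(complete_typeN (type_spaceP q)).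
Qed.

Lemma types_over_plug k Y (phi : formula L ('I_k + Y)) (p : set (formula L (Y + M))) :
  types_over M Y p ->
  exists (phi' : formula L ('I_k + I)) (q : type_space cbar),
    forall a : 'I_k -> M, p (plug a phi) <-> sval q (plug a phi').
Proof.
move=> pc; have [l [b [theta ->]]] := formula_support_right phi.
have [j [q qP]] := types_over_transport (complete_type_pull b id pc).
exists (rename (vsum inl (inr \o j)) theta), q => a.
have plugE Z (f : 'I_l -> Z) :
    plug a (rename (vsum inl (inr \o f)) theta) =
    rename (vsum (inl \o f) inr) (plug a theta).
  by rewrite /plug !rename_comp; congr rename; apply/funext => -[].
by rewrite !plugE; exact: qP.
Qed.

(** * The common form of the colorings *)

(** The kinds of colorings differ in the set [S] of types and the set [Delta]
    of formulas only. *)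
Definition type_coloring (S : set (type_space cbar)) k
    (Delta : set (formula L ('I_k + I))) (a : 'I_k -> M) n
    (c : ('I_k -> M) -> {ffun 'I_n -> bool}) :=
  exists (phi : 'I_n -> formula L ('I_k + I)) (p : 'I_n -> type_space cbar),
  [/\ forall i, Delta (phi i), forall i, S (p i) &
  forall a', binom setT a a' -> forall i, c a' i <-> sval (p i) (plug a' (phi i))].

Lemma definable_coloringE k (a : 'I_k -> M) n
    (c : ('I_k -> M) -> {ffun 'I_n -> bool}) :
  definable_coloring a c <->
  type_coloring (range (fun s => type_act s (type_point cbar))) setT a c.
Proof.
split=> [[phi cphi]|[theta [p [_ Sp cp]]]].
  have [j jK] := enumeration_section.
  exists (fun i => rename (vsum inl (inr \o j)) (phi i)), (fun=> type_point cbar).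
  split=> // [i|a' aa' i]; first by exists 1%g => //; rewrite type_act1.
  apply: iff_trans (cphi a' aa' i) _.
  rewrite /= /tp /= sat_plug sat_rename.
  suff -> : vsum a' cbar \o vsum inl (inr \o j) = vsum a' id by [].
  by apply/funext => -[x|m] //=; rewrite jK.
have /choice[s sE] : forall i, exists s : aut M, type_act s (type_point cbar) = p i.
  by move=> i; have [s _] := Sp i; exists s.
exists (fun i => rename (vsum inl (inr \o (s i \o cbar))) (theta i)) => a' aa' i.
apply: iff_trans (cp a' aa' i) _; rewrite -sE.
apply: iff_trans (type_act_pointE _ _ _) _.
rewrite sat_plug sat_rename.
suff -> : vsum a' id \o vsum inl (inr \o (s i \o cbar)) = vsum a' (s i \o cbar) by [].
by apply/funext => -[].
Qed.

Lemma ext_definable_coloringE k (a : 'I_k -> M) n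
    (c : ('I_k -> M) -> {ffun 'I_n -> bool}) :
  ext_definable_coloring a c <-> type_coloring setT setT a c.
Proof.
split=> [[Y [phi [p [pc cp]]]]|[theta [p [_ _ cp]]]]; last first.
  by exists I, theta, (fun i => sval (p i)); split=> // i; exact: type_spaceP.
have /choice[x xP] : forall i, exists x : formula L ('I_k + I) * type_space cbar,
    forall a', p i (plug a' (phi i)) <-> sval x.2 (plug a' x.1).
  by move=> i; have [phi' [q qP]] := types_over_plug (phi i) (pc i); exists (phi', q).
exists (fun i => (x i).1), (fun i => (x i).2); split=> // a' aa' i.
exact: iff_trans (cp a' aa' i) (xP _ _).
Qed.

Lemma ext_definable_Delta_coloringE k (a : 'I_k -> M) Delta n
    (c : ('I_k -> M) -> {ffun 'I_n -> bool}) :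
  ext_definable_Delta_coloring cbar a Delta c <-> type_coloring setT Delta a c.
Proof.
split=> [[phi [p [dphi pc cp]]]|[theta [p [dphi _ cp]]]].
  by exists phi, (fun i => exist _ (p i) (pc i)).
by exists theta, (fun i => sval (p i)); split=> // i; exact: svalP.
Qed.

(** * Colorings of copies and colorings of the group *)

Let A := type_ambit cbar hM.

Definition plug_boxes k (a : 'I_k -> M) (Delta : set (formula L ('I_k + I))) :
    set (set (type_space cbar)) :=
  (fun phi => type_box (plug a phi)) @` Delta.

Lemma plug_boxes_clopen k (a : 'I_k -> M) Delta : plug_boxes a Delta `<=` clopen.
Proof. by move=> _ [phi _ <-]; exact: type_box_clopen. Qed.

Lemma clopen_plug_boxes (Sigma : set (set (type_space cbar))) :
  finite_set Sigma -> Sigma `<=` clopen ->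
  exists k (a : 'I_k -> M) Delta, finite_set Delta /\ Sigma = plug_boxes a Delta.
Proof.
move=> /finite_set_rangeP[N [U ->]] clU.
have /choice[psi psiE] : forall i, exists phi, U i = type_box phi.
  by move=> i; apply: type_clopen_box; apply: clU; exists i.
have [k [a [theta thetaE]]] := plug_family psi.
exists k, a, (range theta); split; first exact/finite_image/finite_finset.
rewrite /plug_boxes image_comp; congr (image setT).
by apply/funext => i /=; rewrite psiE thetaE.
Qed.

Lemma binom_aut k (a : 'I_k -> M) (g : aut M) : binom setT a (g \o a).
Proof. by split => //; rewrite tp_aut. Qed.

(** A coloring of the copies of [a] is pulled back along the orbit map of [a];
    the next lemma says that every coloring of the group given by boxes
    [phi(a, y)] arises in this way. *)
Lemma type_coloring_to_group (S : set (type_space cbar)) k Delta (a : 'I_k -> M) n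
    (c : ('I_k -> M) -> {ffun 'I_n -> bool}) :
  type_coloring S Delta a c ->
  @S_definable_coloring A S (plug_boxes a Delta) n (fun g : aut M => c (g \o a)).
Proof.
move=> [phi [p [Dphi Sp cp]]]; exists (fun i => type_box (plug a (phi i))), p.
split=> // [i|g i]; first by exists (phi i).
apply: iff_trans (cp _ (binom_aut a g) i) _.
apply: iff_trans (iff_sym (type_act_box _ _ _)).
by rewrite move_params_plug.
Qed.

Lemma type_coloring_of_group (S : set (type_space cbar)) k Delta (a : 'I_k -> M) n
    (C : aut M -> {ffun 'I_n -> bool}) :
  @S_definable_coloring A S (plug_boxes a Delta) n C ->
  exists2 c, type_coloring S Delta a c & forall g, C g = c (g \o a).
Proof.
move=> [U [p [DU Sp Cp]]].
have /choice[phi phiP] : forall i, exists phi, Delta phi /\ type_box (plug a phi) = U i.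
  by move=> i; have [phi] := DU i; exists phi.
pose c (a' : 'I_k -> M) := [ffun i => `[< sval (p i) (plug a' (phi i)) >]].
have cE a' i : c a' i <-> sval (p i) (plug a' (phi i)).
  by rewrite ffunE; split=> /asboolP.
exists c => [|g]; first by exists phi, p; split=> // i; case: (phiP i).
apply/ffunP => i; apply/idP/idP.
  move=> /Cp; rewrite -(phiP i).2 => /type_act_box.
  by rewrite move_params_plug => /cE.
move=> /cE; rewrite -move_params_plug => /type_act_box.
by rewrite (phiP i).2 => /Cp.
Qed.

(** [F] contains one automorphism for each of the finitely many copies of [a]
    inside [B]. *)
Lemma copies_are_translates k (a : 'I_k -> M) (B : set M) :
  finite_set B -> range a `<=` B ->
  exists F : set (aut M), [/\ finite_set F, F !=set0 &
    forall h : aut M, binom (h @` B) a = (fun g => (h * g)%g \o a) @` F].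
Proof.
move=> /finite_set_rangeP[N [e ->]] aB.
(* Tuples in [B] are listed, with repetitions, by finite functions to ['I_N]. *)
pose D := [set f : {ffun 'I_k -> 'I_N} | tp (e \o f) = tp a].
have /choice[G GE] : forall f : {ffun 'I_k -> 'I_N}, exists g : aut M,
    D f -> g \o a = e \o f.
  move=> f; have [Df|nDf] := EM (D f); last by exists 1%g.
  by have [g ga] := finite_homogeneous (esym Df); exists g.
have DE (a' : 'I_k -> M) : range a' `<=` range e -> tp a' = tp a ->
    exists2 f, D f & a' = e \o f.
  move=> a'e taa'.
  have /choice[f fE] : forall x, exists y, e y = a' x.
    by move=> x; have [|y _ ey] := a'e (a' x); [exists x|exists y].
  have E : e \o finfun f = a' by apply/funext => x; rewrite /= ffunE.
  by exists (finfun f); rewrite // /D /= E.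
exists (G @` D); split.
- exact/finite_image/finite_finset.
- by have [f Df _] := DE a aB erefl; exists (G f), f.
move=> h; apply/seteqP; split=> [a' [a'h taa']|_ [_ [f Df <-] <-]].
  have [| |f Df fE] := DE (h^-1%g \o a').
  - move=> _ [x _ <-]; have [|m em hm] := a'h (a' x); first by exists x.
    by rewrite /= -hm aut_funK.
  - by rewrite tp_aut.
  exists (G f); first by exists f.
  apply/funext => x /=; have /= := congr1 (fun u => u x) (GE f Df).
  by move=> ->; have /= := congr1 (fun u => u x) fE => <-; rewrite aut_invK.
split; last by rewrite tp_aut.
move=> _ [x _ <-] /=; exists (G f (a x)) => //.
by have /= := congr1 (fun u => u x) (GE f Df) => ->; exists (f x).
Qed.

(** [B] consists of the entries of [a] and of its translates by [F]. *)
Lemma translates_are_copies k (a : 'I_k -> M) (F : set (aut M)) : finite_set F ->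
  exists B : set M, [/\ finite_set B, range a `<=` B &
    forall h : aut M, (fun g => (h * g)%g \o a) @` F `<=` binom (h @` B) a].
Proof.
move=> fF; pose B := range a `|` \bigcup_(g in F) range (g \o a).
exists B; split.
- rewrite finite_setU; split; first exact/finite_image/finite_finset.
  by apply: bigcup_finite => // g _; exact/finite_image/finite_finset.
- by move=> m am; left.
move=> h _ [g Fg <-]; split; last by rewrite tp_aut.
by move=> _ [x _ <-]; exists (g (a x)) => //; right; exists g => //; exists x.
Qed.

(** * Ramsey properties *)

Lemma copies_degree_of_group (S : set (type_space cbar)) k Delta (a : 'I_k -> M)
    (B : set M) n (c : ('I_k -> M) -> {ffun 'I_n -> bool}) l :
  0 < l ->
  (forall C : aut M -> {ffun 'I_n -> bool}, 0 < n ->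
     @S_definable_coloring A S (plug_boxes a Delta) n C ->
     forall F : set (aut M), finite_set F -> F !=set0 ->
     exists h : aut M, C @` ((fun g => h * g)%g @` F) #<= `I_l) ->
  finite_set B -> range a `<=` B -> type_coloring S Delta a c ->
  exists2 B', binom_set B B' & c @` binom B' a #<= `I_l.
Proof.
move=> l0 RP fB aB ca; case: n c ca RP => [|n] c ca RP.
  (* Colorings of the group have [0 < n]; for [n = 0] there is one color. *)
  exists B; first by exists 1%g; rewrite image_id.
  apply: (@card_le_trans _ _ _ [set c a]).
    by apply: subset_card_le => _ [a' _ <-] /=; apply/ffunP => -[].
  by rewrite (card_le_eql (@card_set1 _ (c a))) card_le_II.
have [F [fF F0 FE]] := copies_are_translates fB aB.
have [h hF] := RP _ isT (type_coloring_to_group ca) F fF F0.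
exists (h @` B); first by exists h.
by move: hF; rewrite FE !image_comp.
Qed.

Lemma group_degree_of_copies (S : set (type_space cbar)) k Delta (a : 'I_k -> M)
    (F : set (aut M)) n (C : aut M -> {ffun 'I_n -> bool}) l :
  (forall (B : set M) (c : ('I_k -> M) -> {ffun 'I_n -> bool}),
     finite_set B -> range a `<=` B -> type_coloring S Delta a c ->
     exists2 B', binom_set B B' & c @` binom B' a #<= `I_l) ->
  finite_set F -> @S_definable_coloring A S (plug_boxes a Delta) n C ->
  exists h : aut M, C @` ((fun g => h * g)%g @` F) #<= `I_l.
Proof.
move=> RP fF /type_coloring_of_group[c ca CE].
have [B [fB aB FB]] := translates_are_copies a fF.
have [_ [h ->] hB] := RP B c fB aB ca.
exists h; apply: card_le_trans hB; apply: subset_card_le.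
move=> _ [_ [g Fg <-] <-]; rewrite CE.
by exists ((h * g)%g \o a) => //; apply: FB; exists g.
Qed.

(** With [S] the orbit of tp(cbar/M) the colorings of copies are the definable
    ones, and with [S] the whole space they are the externally definable ones. *)
Lemma Ramsey_property_transfer (S : set (type_space cbar)) :
  (forall (B : set M) k (a : 'I_k -> M) n
     (c : ('I_k -> M) -> {ffun 'I_n -> bool}),
   finite_set B -> range a `<=` B -> type_coloring S setT a c ->
   exists2 B', binom_set B B' & c @` binom B' a #= `I_1) <->
  @RP_for A S.
Proof.
split=> [RP n C n0 [U [p [clU Sp Cp]]] F fF F0|RP B k a n c fB aB ca].
  have [||k [a [Delta [_ UE]]]] := @clopen_plug_boxes (range U).
  - exact/finite_image/finite_finset.
  - by move=> _ [i _ <-]; exact: clU.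
  have [] := @group_degree_of_copies S k setT a F n C 1; first 2 last.
  - exists U, p; split=> // i.
    have : plug_boxes a Delta (U i) by rewrite -UE; exists i.
    by move=> [phi _ <-]; exists phi.
  - move=> h hF; exists h; rewrite card_eq1_nonempty//.
    by have [g Fg] := F0; exists (C (h * g)%g), (h * g)%g => //; exists g.
  - move=> B c fB aB ca; have [B' BB' cB'] := RP B k a n c fB aB ca.
    by exists B'; rewrite // -(card_le_eqr cB').
  - exact: fF.
have [||||B' [h ->] hB] := @copies_degree_of_group S k setT a B n c 1 isT => //.
  move=> C n0 [U [p [DU Sp Cp]]] F fF F0.
  have [|h hF] := RP n C n0 _ F fF F0.
    by exists U, p; split=> // i; exact: plug_boxes_clopen (DU i).
  by exists h; rewrite -(card_le_eqr hF).
exists (h @` B); first by exists h.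
rewrite card_eq1_nonempty//; exists (c (h \o a)), (h \o a) => //.
split; last by rewrite tp_aut.
by move=> _ [x _ <-]; exists (a x) => //; apply: aB; exists x.
Qed.

Lemma Ramsey_degree_transfer : sep_fin_EDEERdeg cbar <-> sep_fin_EDRdeg A.
Proof.
split=> [deg G X Sigma fS clS|deg k a Delta fD].
  have [k [a [Delta [fD ->]]]] := clopen_plug_boxes fS clS.
  (* A degree of the ambit is positive, whence the successor. *)
  have [l lP] := deg k a Delta fD; exists l.+1 => // n C n0 CS F fF F0.
  apply: group_degree_of_copies fF CS => B c fB aB /ext_definable_Delta_coloringE ca.
  have [B' BB' cB'] := lP B n c fB aB ca; exists B' => //.
  by apply: card_le_trans cB' _; rewrite card_le_II.
have [||l l0 lP] := deg (plug_boxes a Delta).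
- exact: finite_image.
- exact: plug_boxes_clopen.
exists l => B n c fB aB /ext_definable_Delta_coloringE ca.
by apply: copies_degree_of_group fB aB ca => // C; exact: lP.
Qed.

End Monster.

Theorem proposition4p6 (L : language) (T : set (sentence L))
  (M : structure L) (I : Type) (cbar : I -> M)
  (hT : complete_theory T) (hM : monster_model T M)
  (hc : enumeration cbar) :
  ((DEERP M <-> DRP (type_ambit cbar hM)) /\
   (EDEERP M <-> EDRP (type_ambit cbar hM))) /\
  (sep_fin_EDEERdeg cbar <-> sep_fin_EDRdeg (type_ambit cbar hM)).
Proof.
split; last exact: Ramsey_degree_transfer.
split; apply: iff_trans (Ramsey_property_transfer _ _).
  by split=> RP B k a n c fB aB /(definable_coloringE hc); exact: RP.
by split=> RP B k a n c fB aB /(ext_definable_coloringE hM hc); exact: RP.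
Qed.
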